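(* Let $\boldsymbol{\beta}=(\beta_0,\ldots,\beta_{p-1})$ be an alternate base of length $p$ and let $\boldsymbol{D}=(D_0,\ldots,D_{p-1})$ be a $p$-tuple of alphabets of integers containing $0$. Let $\delta=\prod_{i=0}^{p-1}\beta_i$. Then the following assertions are equivalent. (1) The set $Z(\boldsymbol{\beta},\boldsymbol{D})$ is accepted by a finite Büchi automaton. (2) The spectrum $X^{\mathcal{D}}(\delta)$ has no accumulation point in $\mathbb{R}$. (3) The zero automaton $\mathcal{Z}(\boldsymbol{\beta},\boldsymbol{D})$ is finite.
   Context: $\mathbb N=\{0,1,2,\dots\}$; alphabets are finite sets; empty products equal $1$ and empty sums equal $0$. An alternate base of length $p\ge1$ is a $p$-tuple $\boldsymbol\beta=(\beta_0,\ldots,\beta_{p-1})$ of real numbers greater than $1$. Each $D_i$ is a finite set of integers with $0\in D_i$. For all $n\in\mathbb Z$, $\beta_n=\beta_{n\bmod p}$ and $D_n=D_{n\bmod p}$. $Z(\boldsymbol\beta,\boldsymbol D)$ is the set of infinite words $a=a_0a_1a_2\cdots$ over $\bigcup_{i=0}^{p-1}D_i$ such that $a_n\in D_n$ for all $n\in\mathbb N$ and $\sum_{n=0}^{+\infty}\frac{a_n}{\prod_{k=0}^n\beta_k}=0$. For $i\in\{0,\dots,p-1\}$ let $\mathcal D^{(i)}=\{\sum_{j=0}^{p-1}a_j\,\beta_{i+j+1}\cdots\beta_{i+p-1} : a_j\in D_{i+j}\text{ for all }j\in\{0,\ldots,p-1\}\}$ and let $\mathcal D=\mathcal D^{(0)}$.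 For a finite set $A\subset\mathbb C$, the spectrum of $\delta$ over $A$ is $X^A(\delta)=\{\sum_{n=0}^{\ell-1}d_n\delta^{\ell-1-n} : \ell\in\mathbb N,\ d_0,\dots,d_{\ell-1}\in A\}$. Write $X(i)=X^{\mathcal D^{(i)}}(\delta)$, so $X(0)=X^{\mathcal D}(\delta)$. A Büchi automaton is a quintuple $(Q,I,F,B,E)$ with states $Q$, initial states $I\subseteq Q$, final states $F\subseteq Q$, finite alphabet $B$ and transitions $E\subseteq Q\times B\times Q$ (not necessarily deterministic). It is finite if $Q$ is finite. An infinite word is accepted if it labels an infinite path starting in an initial state and visiting final states infinitely many times. The set accepted is the set of all accepted infinite words. For $i\in\{0,\dots,p-1\}$ set $M^{(i)}=\sum_{n=i}^{+\infty}\frac{\max(D_n)}{\prod_{k=i}^n\beta_k}$ and $m^{(i)}=\sum_{n=i}^{+\infty}\frac{\min(D_n)}{\prod_{k=i}^n\beta_k}$. The zero automaton $\mathcal Z(\boldsymbol\beta,\boldsymbol D)$ is the Büchi automaton with set of states $\bigcup_{i=0}^{p-1}\big(\{i\}\times(X(i)\cap[-M^{(i)},-m^{(i)}])\big)$, initial state $(0,0)$, all states final, alphabet $\bigcup_{i=0}^{p-1}D_i$, and with a transition from state $(i,s)$ to state $(j,t)$ labeled $a$ if and only if $j\equiv i+1\pmod p$, $a\in D_i$ and $t=\beta_i s+a$. *)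

(* Defs.v *)
From HB Require Import structures.
From mathcomp Require Import all_boot all_order all_algebra finmap.
From mathcomp Require Import all_classical all_reals all_analysis.

Set Implicit Arguments.
Unset Strict Implicit.
Unset Printing Implicit Defensive.

Import Order.TTheory GRing.Theory Num.Theory.
Import numFieldNormedType.Exports.

Local Open Scope classical_set_scope.
Local Open Scope ring_scope.

(* Infinite words over an alphabet contained in L are functions nat -> L. *)
Record buchi (L : choiceType) := Buchi {
  state : Type;
  initial : set state;
  final : set state;
  alphabet : {fset L};
  transition : set (state * alphabet * state)
}.

Definition finite_buchi (L : choiceType) (A : buchi L) : Prop :=
  finite_set [set: state A].

(* The word w is the sequence of labels b of a path q. *)
Definition accepted (L : choiceType) (A : buchi L) : set (nat -> L) :=
  [set w | exists (q : nat -> state A) (b : nat -> alphabet A),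
    [/\ initial (q 0%N),
        forall n, transition (q n, b n, q n.+1),
        forall n, w n = val (b n)
      & infinite_set [set n | final (q n)]]].

(* For n < l the exponent l - n.+1 is the integer l - 1 - n. *)
Definition spectrum (K : nzRingType) (A : set K) (delta : K) : set K :=
  [set x | exists (l : nat) (d : 'I_l -> K),
    (forall n, A (d n)) /\ x = \sum_(n < l) d n * delta ^+ (l - n.+1)].

(* The bases and the alphabets are indexed by all natural numbers, modulo p.
   For p > 0 the default values of nth are never used. *)
Definition base_at (R : realType) (p : nat) (beta : p.-tuple R) (n : nat) : R :=
  nth 1 beta (n %% p).

Definition digits_at (p : nat) (D : p.-tuple {fset int}) (n : nat) :
    {fset int} :=
  nth fset0 D (n %% p).

Definition base_product (R : realType) (p : nat) (beta : p.-tuple R) : R :=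
  \prod_(0 <= i < p) base_at beta i.

Definition zero_words (R : realType) (p : nat) (beta : p.-tuple R)
    (D : p.-tuple {fset int}) : set (nat -> int) :=
  [set a | (forall n, a n \in digits_at D n) /\
    (fun N => \sum_(0 <= n < N)
       (a n)%:~R / \prod_(0 <= k < n.+1) base_at beta k) @ \oo --> (0 : R)].

Definition block_digits (R : realType) (p : nat) (beta : p.-tuple R)
    (D : p.-tuple {fset int}) (i : nat) : set R :=
  [set x | exists a : 'I_p -> int,
    (forall j : 'I_p, a j \in digits_at D (i + j)) /\
    x = \sum_(j < p)
          (a j)%:~R * \prod_((i + j).+1 <= k < i + p) base_at beta k].

(* When 0 belongs to A, these are the maximum and the minimum of A. *)
Definition max_digit (A : {fset int}) : int := \big[Num.max/0]_(d <- A) d.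
Definition min_digit (A : {fset int}) : int := \big[Num.min/0]_(d <- A) d.

(* The limits exist when all the bases are greater than 1. *)
Definition max_value (R : realType) (p : nat) (beta : p.-tuple R)
    (D : p.-tuple {fset int}) (i : nat) : R :=
  limn (fun N => \sum_(i <= n < N)
    (max_digit (digits_at D n))%:~R / \prod_(i <= k < n.+1) base_at beta k).

Definition min_value (R : realType) (p : nat) (beta : p.-tuple R)
    (D : p.-tuple {fset int}) (i : nat) : R :=
  limn (fun N => \sum_(i <= n < N)
    (min_digit (digits_at D n))%:~R / \prod_(i <= k < n.+1) base_at beta k).

Definition zero_states (R : realType) (p : nat) (beta : p.-tuple R)
    (D : p.-tuple {fset int}) : set ('I_p * R) :=
  [set q : 'I_p * R |
    spectrum (block_digits beta D q.1) (base_product beta) q.2 /\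
    q.2 \in `[- max_value beta D q.1, - min_value beta D q.1]].

Definition digit_alphabet (p : nat) (D : p.-tuple {fset int}) : {fset int} :=
  \big[fsetU/fset0]_(i < p) tnth D i.

Definition zero_automaton (R : realType) (p : nat) (beta : p.-tuple R)
    (D : p.-tuple {fset int}) : buchi int :=
  {| state := zero_states beta D;
     initial := [set q : zero_states beta D |
       (val q).1 = 0%N :> nat /\ (val q).2 = 0];
     final := setT;
     alphabet := digit_alphabet D;
     transition := [set e : zero_states beta D * digit_alphabet D *
                            zero_states beta D |
       let: (q, a, r) := e in
       let: (i, s) := val q in
       let: (j, t) := val r in
       [/\ (j = i.+1 %[mod p])%N,
           val a \in digits_at D i
         & t = base_at beta i * s + (val a)%:~R]] |}.

(* Main.v *)
Require Import Defs.
From mathcomp Require Import all_boot all_order all_algebra finmap.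
From mathcomp Require Import all_classical all_reals all_analysis.
From mathcomp Require Import ring lra.

(** Read a word [a] from left to right and follow the Horner values
    [s_0 = 0], [s_(n+1) = b_n * s_n + a_n].  The [n]-th partial sum of the
    series of [a] is [s_n] divided by [b_0 ... b_(n-1)], so the series vanishes
    exactly when [- s_n] is, for each [n], the sum of the series of the digits
    that are still to be read.  The spectrum X(i) is the set of the values that
    can be reached from 0 between two times congruent to [i] modulo [p]
    ([spectrumP]), because reading [p] digits is one Horner step in base delta.

    Third assertion to the first: the zero automaton computes [s_n].  Along a
    zero word, [s_n] is the opposite of a tail and so lies between the opposites
    of the extremal tails; conversely a word whose values stay bounded is a zero
    word, the denominators growing geometrically ([accepted_zero_automaton]).

    Second assertion to the third: completing words by zeros embeds X(i) in X(0)
    up to a scalar ([spectrum_pad]); by Bolzano-Weierstrass an infinite bounded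
    part of X(i) would give an accumulation point of X(0).

    First assertion to the second.  Let a finite automaton accept the zero words.
    If two accepting runs are in the same state at times congruent modulo [p],
    the past of one can be followed by the future of the other, and this future
    determines the value [s_n]; so the zero words take only finitely many values
    ([finite_core]).  It remains to see that only finitely many values of absolute
    value at most [C] are reachable at all ([finite_reach]), even by words that no
    continuation makes zero words.  Such a word either never leaves the finite set
    of core values, or leaves it through one of finitely many exit values.  From
    an exit value [v] only finitely many bounded values are reachable: otherwise
    Koenig's lemma gives an infinite path from [v] along which infinitely many
    bounded values remain reachable ([infinite_reach_live]).  A large value only
    grows ([walk_norm]), so that path is bounded, hence prolongs the past of [v]
    to a zero word, contrary to the choice of [v]. *)

Set Implicit Arguments.
Unset Strict Implicit.
Unset Printing Implicit Defensive.

Import Order.TTheory GRing.Theory Num.Theory.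
Import numFieldNormedType.Exports.

Local Open Scope classical_set_scope.
Local Open Scope ring_scope.

(** * Preliminaries *)

Lemma infinite_nat_shift (S : set nat) (n m : nat) :
  infinite_set S -> infinite_set [set k | (n <= k)%N /\ S (m + (k - n))%N].
Proof.
move=> inf fin; apply: inf.
apply: (@sub_finite_set _ _ (`I_m `|`
  (fun k => m + (k - n))%N @` [set k | (n <= k)%N /\ S (m + (k - n))%N])).
  move=> k Sk; have [km|mk] := ltnP k m; first by left.
  right; exists (n + (k - m))%N; rewrite ?addKn ?subnKC//.
  by split; rewrite /= ?leq_addr// addKn subnKC.
by rewrite finite_setU; split; [exact: finite_II|exact: finite_image].
Qed.

Lemma limit_pointS (T : topologicalType) (E E' : set T) x :
  E `<=` E' -> limit_point E x -> limit_point E' x.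
Proof. by move=> EE' h U /h[y [yx Ey Uy]]; exists y; split => //; exact: EE'. Qed.

Lemma norm_le_itvN (R : realDomainType) (M m x : R) :
  - M <= x <= - m -> `|x| <= `|M| + `|m|.
Proof.
move=> /andP[Mx xm]; rewrite ler_norml; apply/andP; split.
  rewrite opprD (le_trans _ Mx)// (le_trans (y := - `|M|))//.
    by rewrite gerDl oppr_le0.
  by rewrite lerN2 ler_norm.
by rewrite (le_trans xm)// (le_trans (ler_norm _))// normrN lerDr.
Qed.

(** * Horner values and tails of words *)

Section Runs.
Variables (R : realType) (b : nat -> R).

(** The times [n], [n + 1], ... fix the bases that are used, whereas the word [a]
    is always indexed from 0. *)
Fixpoint run (n : nat) (s : R) (a : nat -> int) (k : nat) : R :=
  if k is k'.+1 then b (n + k') * run n s a k' + (a k')%:~R else s.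

Definition weight (n k : nat) : R := \prod_(n <= j < n + k) b j.

Definition tail_sum (n : nat) (a : nat -> int) (k : nat) : R :=
  \sum_(0 <= j < k) (a j)%:~R / weight n j.+1.

(** The word [a], read from time [n] on, is an expansion of [- s]; for [n = 0]
    and [s = 0] this is the vanishing of the series of [a]. *)
Definition cancels (n : nat) (s : R) (a : nat -> int) : Prop :=
  tail_sum n a @ \oo --> - s.

Lemma weight0 n : weight n 0 = 1.
Proof. by rewrite /weight addn0 big_geq. Qed.

Lemma weightS n k : weight n k.+1 = weight n k * b (n + k).
Proof. by rewrite /weight addnS big_nat_recr //= leq_addr. Qed.

Lemma weightD n m k : weight n (m + k) = weight n m * weight (n + m) k.
Proof.
elim: k => [|k IH]; first by rewrite addn0 weight0 mulr1.
by rewrite addnS !weightS IH mulrA addnA.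
Qed.

Lemma tail_sum0 n a : tail_sum n a 0 = 0.
Proof. by rewrite /tail_sum big_geq. Qed.

Lemma tail_sumS n a k :
  tail_sum n a k.+1 = tail_sum n a k + (a k)%:~R / weight n k.+1.
Proof. by rewrite /tail_sum big_nat_recr. Qed.

Lemma eq_run n s a a' k :
  (forall j, (j < k)%N -> a j = a' j) -> run n s a k = run n s a' k.
Proof.
elim: k => // k IH aE /=; rewrite aE// IH// => j jk.
by apply: aE; exact: ltnW.
Qed.

Lemma run_add n s a m k :
  run n s a (m + k) = run (n + m) (run n s a m) (fun j => a (m + j)%N) k.
Proof.
elim: k => [|k IH]; first by rewrite addn0.
by rewrite addnS /= IH addnA.
Qed.

Lemma run_affine n s a k : run n s a k = weight n k * s + run n 0 a k.
Proof.
elim: k => [|k IH] /=; first by rewrite weight0; ring.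
by rewrite IH weightS; ring.
Qed.

(** The digits enter with the same coefficients as in the block digits of the
    spectrum. *)
Lemma run_horner n a k :
  run n 0 a k = \sum_(j < k) (a j)%:~R * \prod_((n + j).+1 <= l < n + k) b l.
Proof.
elim: k => [|k IH] /=; first by rewrite big_ord0.
rewrite IH big_ord_recr /= addnS big_geq ?mulr1//; congr (_ + _).
rewrite mulr_sumr; apply: eq_bigr => j _.
by rewrite big_nat_recr/= ?ltn_add2l//; ring.
Qed.

Lemma run_zeros n k : run n 0 (fun=> 0) k = 0.
Proof. by elim: k => //= k ->; rewrite mulr0 addr0. Qed.

End Runs.

(** * Uniformly expanding bases *)

Section ExpandingBase.
Variables (R : realType) (b : nat -> R) (gamma : R).
Hypothesis gamma1 : 1 < gamma.
Hypothesis gamma_le : forall n, gamma <= b n.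

Lemma weight_ge n k : gamma ^+ k <= weight b n k.
Proof.
have g0 : 0 <= gamma by apply: ltW; exact: lt_trans gamma1.
elim: k => [|k IH]; first by rewrite weight0.
by rewrite exprSr weightS ler_pM // exprn_ge0.
Qed.

Lemma weight_gt0 n k : 0 < weight b n k.
Proof.
apply: lt_le_trans (weight_ge n k); apply: exprn_gt0.
exact: lt_trans gamma1.
Qed.

Lemma run_tail n s a k :
  run b n s a k = weight b n k * (s + tail_sum b n a k).
Proof.
elim: k => [|k IH] /=.
  by rewrite weight0 tail_sum0 addr0 mul1r.
have := weight_gt0 n k.+1.
rewrite IH tail_sumS weightS => w0.
have : b (n + k) != 0 by apply: contraTneq w0 => ->; rewrite mulr0 ltxx.
have : weight b n k != 0 by rewrite gt_eqF ?weight_gt0.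
by move=> ? ?; field; apply/andP.
Qed.

Lemma tail_sum_add n a m k : tail_sum b n a (m + k) =
  tail_sum b n a m + tail_sum b (n + m) (fun j => a (m + j)%N) k / weight b n m.
Proof.
have w0 : weight b n m != 0 by rewrite gt_eqF ?weight_gt0.
elim: k => [|k IH].
  by rewrite addn0 tail_sum0 mul0r addr0.
rewrite addnS !tail_sumS IH -addnS weightD.
have w1 : weight b (n + m) k.+1 != 0 by rewrite gt_eqF ?weight_gt0.
by field; apply/andP.
Qed.

Lemma cancels_inj n s s' a : cancels b n s a -> cancels b n s' a -> s = s'.
Proof.
move=> h h'; apply: oppr_inj; exact: (cvg_unique _ h h').
Qed.

(** Reading [m] digits subtracts them from the tail and rescales by the weight,
    which is what [run] does to the value. *)
Lemma cancels_shift n s a m : cancels b n s a <->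
  cancels b (n + m) (run b n s a m) (fun j => a (m + j)%N).
Proof.
have w0 : weight b n m != 0 by rewrite gt_eqF ?weight_gt0.
pose u := tail_sum b (n + m) (fun j => a (m + j)%N).
have E : (fun k => tail_sum b n a (k + m)%N) =
         (fun k => tail_sum b n a m + u k / weight b n m).
  by apply/funext => k; rewrite addnC tail_sum_add.
have E' : u =
   (fun k => (tail_sum b n a (k + m)%N - tail_sum b n a m) * weight b n m).
  apply/funext => k; rewrite [tail_sum b n a (k + m)](congr1 (@^~ k) E).
  by field.
rewrite /cancels run_tail -/u; split => h.
  rewrite E'.
  rewrite (_ : - (_ * _) = (- s - tail_sum b n a m) * weight b n m); last by ring.
  apply: cvgMr_tmp; apply: cvgB; last exact: cvg_cst.
  by move: h; rewrite -(cvg_shiftn m).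
rewrite -(cvg_shiftn m) E.
rewrite (_ : - s = tail_sum b n a m +
  (- (weight b n m * (s + tail_sum b n a m))) / weight b n m); last by field.
by apply: cvgD; [exact: cvg_cst|exact: cvgMr_tmp].
Qed.

(** The partial sums differ from [- s] by the value divided by the weight, and
    the weight is at least [gamma ^+ k]. *)
Lemma bounded_cancels C n s a :
  (forall k, `|run b n s a k| <= C) -> cancels b n s a.
Proof.
move=> bnd.
have g0 : 0 < gamma by exact: lt_trans gamma1.
have C0 : 0 <= C by exact: le_trans (normr_ge0 _) (bnd 0%N).
suff : (fun k => run b n s a k / weight b n k) @ \oo --> (0 : R).
  move=> h; rewrite /cancels.
  rewrite (_ : tail_sum b n a = (fun k => run b n s a k / weight b n k - s)).
    by have := cvgB h (cvg_cst s); rewrite sub0r; apply.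
  apply/funext => k; rewrite run_tail.
  have w0 : weight b n k != 0 by rewrite gt_eqF ?weight_gt0.
  by field.
have cg : (fun k => C * gamma^-1 ^+ k) @ \oo --> (0 : R).
  apply: (@cvg_geometric _ C gamma^-1).
  by rewrite ger0_norm ?invr_ge0 ?(ltW g0)// invf_lt1.
apply/norm_cvg0P.
apply: squeeze_cvgr _ (cvg_cst 0) cg; apply: nearW => k.
rewrite normr_ge0 /= normrM normfV (gtr0_norm (weight_gt0 n k)).
rewrite exprVn ler_pM ?invr_ge0 ?(ltW (weight_gt0 n k))//.
by rewrite lef_pV2 ?posrE ?weight_gt0 ?exprn_gt0 ?weight_ge.
Qed.

(** * Reachable values and Koenig's lemma *)

Section Digits.
(* [K] is the fixed point of [x |-> gamma * x - K * (gamma - 1)], which bounds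
   from below the absolute value of the next value. *)
Variables (G : nat -> {fset int}) (K : R).
Hypothesis G0 : forall n, 0 \in G n.
Hypothesis K0 : 0 <= K.
Hypothesis leK : forall n d, d \in G n -> `|d%:~R| <= K * (gamma - 1).

Definition admissible n (a : nat -> int) := forall j, a j \in G (n + j).

Lemma admissible_shift n m a : admissible n a ->
  admissible (n + m) (fun j => a (m + j)%N).
Proof. by move=> h j; rewrite -addnA; exact: h. Qed.

(** Finite runs seen as a relation between pairs (time, value); the digits are
    forgotten, so that walks compose without concatenating words. *)
Inductive walk (n : nat) (s : R) : nat -> R -> Prop :=
| walk_nil : walk n s n s
| walk_rcons m t d : walk n s m t -> d \in G m ->
    walk n s m.+1 (b m * t + d%:~R).

Lemma walk_trans n s m t l u : walk n s m t -> walk m t l u -> walk n s l u.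
Proof. by move=> nm; elim=> // {}l {}u d _ IH; exact: walk_rcons. Qed.

Lemma walk_run n s a k : admissible n a -> walk n s (n + k) (run b n s a k).
Proof.
move=> adm; elim: k => [|k IH]; first by rewrite addn0; exact: walk_nil.
by rewrite addnS; exact: walk_rcons.
Qed.

(** The digits of a walk can be completed by zeros to an infinite word. *)
Lemma walkP n s m t : walk n s m t ->
  exists a k, [/\ admissible n a, m = (n + k)%N & t = run b n s a k].
Proof.
elim => [|{}m {}t d _ [a [k [adm -> ->]]] dG].
  by exists (fun=> 0), 0%N; split => //; rewrite addn0.
exists (fun j => if j == k then d else a j), k.+1; split.
- by move=> j; case: eqP => [->//|_]; exact: adm.
- by rewrite addnS.
- rewrite /= eqxx; congr (_ * _ + _); apply: eq_run => j jk.
  by rewrite ltn_eqF.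
Qed.

Lemma walk_split n s m t : walk n s m t -> (n = m /\ s = t) \/
  exists2 d, d \in G n & walk n.+1 (b n * s + d%:~R) m t.
Proof.
elim => [|{}m {}t d _ IH dG]; first by left.
right; case: IH dG => [[<- <-]|[e eG w]] dG.
  by exists d => //; exact: walk_nil.
by exists e => //; exact: walk_rcons.
Qed.

Lemma walk_zeros n k : walk n 0 (n + k) 0.
Proof. by rewrite -[in X in walk _ _ _ X](run_zeros b n k); exact: walk_run. Qed.

(** Beyond [K] absolute values increase at each step, so a walk that ends in a
    ball of radius at least [K] has never left it. *)
Lemma walk_norm C n s m t : K <= C -> walk n s m t -> `|t| <= C -> `|s| <= C.
Proof.
move=> KC; elim => // {}m {}t d _ IH dG tC; apply: IH.
rewrite leNgt; apply/negP => Ct.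
have := leK dG.
have := lerB_normD (b m * t) d%:~R.
have -> : `|b m * t| = b m * `|t|.
  rewrite normrM ger0_norm //; apply: le_trans (gamma_le m).
  by apply: ltW; exact: lt_trans gamma1.
have := gamma_le m; move: tC gamma1 Ct KC K0; nra.
Qed.

Lemma cvg_tail_sum n a : admissible n a -> cvgn (tail_sum b n a).
Proof.
move=> adm.
have g0 : 0 < gamma by exact: lt_trans gamma1.
change (cvgn (series (fun j => (a j)%:~R / weight b n j.+1 : R))).
apply: normed_cvg.
apply: (@series_le_cvg _ _ (geometric (K * (gamma - 1)) gamma^-1)).
- by move=> j; exact: normr_ge0.
- move=> j; rewrite /geometric/= mulr_ge0 ?exprn_ge0 ?invr_ge0 ?(ltW g0)//.
  by rewrite mulr_ge0// subr_ge0 ltW.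
- move=> j; rewrite /geometric/= normrM normfV (gtr0_norm (weight_gt0 _ _)).
  rewrite ler_pM ?invr_ge0 ?(ltW (weight_gt0 _ _))//; first exact: leK (adm j).
  rewrite exprVn lef_pV2 ?posrE ?weight_gt0 ?exprn_gt0//.
  apply: le_trans (weight_ge n j.+1).
  by rewrite exprS ler_peMl ?exprn_ge0 ?ltW.
- apply: is_cvg_geometric_series.
  by rewrite ger0_norm ?invr_ge0 ?(ltW g0)// invf_lt1.
Qed.

(** A value that the digits still to come may cancel. *)
Definition live n s := exists2 a, admissible n a & cancels b n s a.

Lemma live0 n : live n 0.
Proof.
exists (fun=> 0) => [j//|]; apply: (@bounded_cancels 0) => k.
by rewrite run_zeros normr0.
Qed.

Definition reach C n s := [set t | exists m, walk n s m t /\ `|t| <= C].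

(** Pigeonhole over the finitely many first digits. *)
Lemma reach_step C n s : infinite_set (reach C n s) ->
  exists2 d, d \in G n & infinite_set (reach C n.+1 (b n * s + d%:~R)).
Proof.
move=> inf; apply: contrapT => noinf; apply: inf.
apply: (@sub_finite_set _ _ ([set s] `|`
  \bigcup_(d in [set` G n]) reach C n.+1 (b n * s + d%:~R))).
  move=> t [m [/walk_split[[_ ->]|[d dG w]] tC]]; first by left.
  by right; exists d => //; exists m.
rewrite finite_setU; split; first exact: finite_set1.
apply: bigcup_finite; first exact: finite_fset.
move=> d dG; apply: contrapT => inf; apply: noinf.
by exists d.
Qed.

(** Koenig's lemma: choose digit after digit so that infinitely many values of
    the ball remain reachable.  As something in the ball remains reachable, the
    path itself stays in the ball by [walk_norm], and a bounded path cancels. *)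
Lemma infinite_reach_live C n s : K <= C -> infinite_set (reach C n s) ->
  live n s.
Proof.
move=> KC inf.
have /choice[f fP] : forall x : nat * R, exists d : int,
    infinite_set (reach C x.1 x.2) ->
    d \in G x.1 /\ infinite_set (reach C x.1.+1 (b x.1 * x.2 + d%:~R)).
  move=> [m t]; have [h|] := pselect (infinite_set (reach C m t)).
    by have [d dG di] := reach_step h; exists d.
  by exists 0.
pose st := fix st k := if k is k'.+1 then
   b (n + k') * st k' + (f ((n + k')%N, st k'))%:~R else s.
have stP k : infinite_set (reach C (n + k) (st k)).
  elim: k => [|k IH]; first by rewrite addn0.
  by rewrite addnS; have [] := fP ((n + k)%N, st k) IH.
exists (fun k => f ((n + k)%N, st k)).
  by move=> k; have [] := fP ((n + k)%N, st k) (stP k).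
apply: (@bounded_cancels C) => k.
have -> : run b n s (fun k => f ((n + k)%N, st k)) k = st k.
  by elim: k => //= k ->.
have /infinite_setN0[t [m [w tC]]] := stP k.
exact: walk_norm KC w tC.
Qed.

(** * Periodic systems and finite automata *)

Section Periodic.
Variable p : nat.
Hypothesis p0 : (0 < p)%N.
Hypothesis b_mod : forall n m, n = m %[mod p] -> b n = b m.
Hypothesis G_mod : forall n m, n = m %[mod p] -> G n = G m.

Let modD n m k : n = m %[mod p] -> (n + k = m + k %[mod p])%N.
Proof. by move=> nm; rewrite -modnDml nm modnDml. Qed.

Lemma weight_mod n m k : n = m %[mod p] -> weight b n k = weight b m k.
Proof.
move=> nm; elim: k => [|k IH]; first by rewrite !weight0.
by rewrite !weightS IH; congr (_ * _); exact/b_mod/modD.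
Qed.

(** One period is a cyclic rotation of another. *)
Lemma weight_period n : weight b n p = weight b 0 p.
Proof.
elim: n => // n <-; have := weightD b n 1 p.
rewrite add1n addn1 weightS (weightS b n 0) weight0 mul1r addn0.
rewrite (b_mod (modnDr n p)) mulrC => /mulfI -> //.
by rewrite gt_eqF// (lt_le_trans _ (gamma_le n))// (lt_trans _ gamma1).
Qed.

Lemma run_mod n m s a k : n = m %[mod p] -> run b n s a k = run b m s a k.
Proof.
move=> nm; elim: k => //= k ->; congr (_ * _ + _).
exact/b_mod/modD.
Qed.

Lemma cancels_mod n m s a : n = m %[mod p] ->
  cancels b n s a -> cancels b m s a.
Proof.
move=> nm; rewrite /cancels (_ : tail_sum b n a = tail_sum b m a)//.
by apply/funext => k; apply: eq_bigr => j _; rewrite (weight_mod _ nm).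
Qed.

Lemma admissible_mod n m a : n = m %[mod p] ->
  admissible n a -> admissible m a.
Proof. by move=> nm h j; rewrite -(G_mod (modD j nm)). Qed.

Lemma live_mod n m s : n = m %[mod p] -> live n s -> live m s.
Proof.
move=> nm [a adm can]; exists a; first exact: admissible_mod adm.
exact: cancels_mod can.
Qed.

Lemma walk_mod n m s l t : n = m %[mod p] -> walk n s (n + l) t ->
  walk m s (m + l) t.
Proof.
move=> nm /walkP[a [k [adm /addnI -> ->]]]; rewrite (run_mod _ _ _ nm).
by apply: walk_run; exact: admissible_mod adm.
Qed.

(** The values taken along zero words. *)
Definition core := [set s | exists n, walk 0 0 n s /\ live n s].

(** A walk from the origin either ends at a live value, hence in the core, or has
    left the live values at some step.  The values just after such a step are
    [exits]: being the image of a core value by one digit, they are finitely many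
    when times are taken modulo [p], and by [infinite_reach_live] each of them
    reaches finitely many values of the ball. *)
Lemma finite_reach C : K <= C -> finite_set core -> finite_set (reach C 0 0).
Proof.
move=> KC fin_core.
(* The pair [(i, v)] stands for the value [v] at time [i + 1]. *)
pose exits := [set v : nat * R | ~ live v.1.+1 v.2 /\
  (\bigcup_(i in `I_p) \bigcup_(s in core) \bigcup_(d in [set` G i])
     [set (i, b i * s + d%:~R)]) v].
have fin_exits : finite_set exits.
  apply: (@sub_finite_set _ _ _ (@subIsetr _ _ _)).
  apply: bigcup_finite => [|i _]; first exact: finite_II.
  apply: bigcup_finite => // s _.
  apply: bigcup_finite => [|d _]; first exact: finite_fset.
  exact: finite_set1.
have dich m t : walk 0 0 m t -> live m t \/ exists v m',
    [/\ exits v, walk v.1.+1 v.2 m' t & m' = m %[mod p]].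
  elim => [|{}m {}t d w IH dG]; first by left; exact: live0.
  case: IH => [lv|[v [m' [ve w' m'm]]]]; last first.
    right; exists v, m'.+1; split => //.
      rewrite -(b_mod m'm); apply: walk_rcons => //.
      by rewrite (G_mod m'm).
    by rewrite -addn1 -[m.+1]addn1; exact: modD.
  have [lv'|nlv] := pselect (live m.+1 (b m * t + d%:~R)); first by left.
  right; exists ((m %% p)%N, b m * t + d%:~R), (m %% p).+1.
  have mm : (m %% p).+1 = m.+1 %[mod p].
    by rewrite -addn1 -[m.+1]addn1; apply: modD; rewrite modn_mod.
  split => //; last exact: walk_nil.
  split; first by move=> /(live_mod mm).
  exists (m %% p)%N; first by rewrite /= ltn_mod.
  exists t; first by exists m.
  exists d; first by rewrite /= (G_mod (modn_mod m p)).
  by rewrite /= (b_mod (modn_mod m p)).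
apply: (@sub_finite_set _ _
  (core `|` \bigcup_(v in exits) reach C v.1.+1 v.2)).
  move=> t [m [w tC]]; have [lv|[v [m' [ve w' _]]]] := dich _ _ w.
    by left; exists m.
  by right; exists v => //; exists m'.
rewrite finite_setU; split => //.
apply: bigcup_finite => // v [nlv _]; apply: contrapT => inf.
by apply: nlv; exact: infinite_reach_live inf.
Qed.

(** A core value is a function of the state and of the residue of the time at
    which an accepting run takes it: the future of any other run in the same
    situation can be grafted after time [n], and [cancels_inj] recovers the value
    from this common future. *)
Lemma finite_core (A : buchi int) : finite_buchi A ->
  accepted A = [set a | admissible 0 a /\ cancels b 0 0 a] ->
  finite_set core.
Proof.
move=> finA accA.
pose runs (w : nat -> int) (q : nat -> state A) := exists c : nat -> alphabet A,
    [/\ initial (q 0%N), forall n, transition (q n, c n, q n.+1),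
        forall n, w n = val (c n) & infinite_set [set n | final (q n)]].
pose rel (x : state A * nat) s := exists n w q,
  [/\ x = (q n, n %% p)%N, runs w q & s = run b 0 0 w n].
have relI x s s' : rel x s -> rel x s' -> s = s'.
  move=> [n [w [q [-> [c [qi qt wc qf]] ->]]]].
  move=> [n' [w' [q' [[qq nn'] [c' [qi' qt' wc' qf']] ->]]]].
  (* Graft the future of [w'] at time [n'] after the past of [w] at time [n]. *)
  pose splice T (f g : nat -> T) k :=
    if (k < n)%N then f k else g (n' + (k - n))%N.
  have : accepted A (splice _ w w').
    exists (splice _ q q'), (splice _ c c'); split.
    - rewrite /splice; case: posnP => // n0.
      by rewrite sub0n addn0 -qq n0.
    - move=> k; rewrite /splice; case: (ltnP k.+1 n) => [kn|nk].
        by rewrite (ltnW kn).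
      have [kn|nk'] := ltnP k n.
        have kn1 : k.+1 = n by apply/eqP; rewrite eqn_leq nk kn.
        by rewrite kn1 subnn addn0 -qq -kn1; exact: qt.
      by rewrite subSn// addnS.
    - by move=> k; rewrite /splice; case: ifP.
    - move=> fin; apply: (infinite_nat_shift (n := n) (m := n') qf').
      apply: sub_finite_set fin => k [nk fk] /=.
      by rewrite /splice ltnNge nk.
  rewrite accA => -[_ /(cancels_shift _ _ _ n)]; rewrite add0n.
  rewrite (_ : run b 0 0 (splice _ w w') n = run b 0 0 w n); last first.
    by apply: eq_run => j jn; rewrite /splice jn.
  rewrite (_ : (fun j => _) = (fun j => w' (n' + j)%N)); last first.
    by apply/funext => j; rewrite /splice ltnNge leq_addr addKn.
  have : accepted A w' by exists q', c'.
  rewrite accA => -[_ /(cancels_shift _ _ _ n')]; rewrite add0n.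
  move=> /(cancels_mod (esym nn')) h' h; exact: cancels_inj h h'.
have /choice[g gP] : forall x, exists s, forall s', rel x s' -> s' = s.
  move=> x; have [[s xs]|no] := pselect (exists s, rel x s).
    by exists s => s' xs'; exact: relI xs' xs.
  by exists 0 => s' xs'; case: no; exists s'.
apply: (@sub_finite_set _ _ (g @` ([set: state A] `*` `I_p))); last first.
  by apply: finite_image; apply: finite_setX => //; exact: finite_II.
move=> s [n [/walkP[u [k [uadm -> ->]]] [v vadm vcan]]].
rewrite add0n in vadm vcan *.
pose w j := if (j < k)%N then u j else v (j - k)%N.
have wk : run b 0 0 w k = run b 0 0 u k.
  by apply: eq_run => j jk; rewrite /w jk.
have : accepted A w.
  rewrite accA; split.
    move=> j; rewrite /w; case: ltnP => [jk|kj]; first exact: uadm.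
    by have := vadm (j - k)%N; rewrite subnKC.
  apply/(cancels_shift _ _ _ k); rewrite add0n wk.
  rewrite (_ : (fun j => _) = v)//; apply/funext => j.
  by rewrite /w ltnNge leq_addr addKn.
move=> [q [c hc]]; exists (q k, k %% p)%N; first by split => //=; rewrite ltn_mod.
apply/esym/gP; exists k, w, q; split => //; by exists c.
Qed.

End Periodic.
End Digits.
End ExpandingBase.

(** * The spectrum and one Horner step *)

Section Spectrum.
Variables (F : nzRingType) (A : set F) (delta : F).

(** The spectrum stratified by the number of digits, to reason by induction. *)
Definition spectrum_at (l : nat) : set F :=
  [set x | exists d : 'I_l -> F,
    (forall n, A (d n)) /\ x = \sum_(n < l) d n * delta ^+ (l - n.+1)].

Lemma spectrum_at0 x : spectrum_at 0 x <-> x = 0.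
Proof.
split=> [[d [_ ->]]|->]; first by rewrite big_ord0.
by exists (fun=> 0); split; [case|rewrite big_ord0].
Qed.

(** Splitting off the last digit is Horner's rule. *)
Lemma spectrum_atS l x : spectrum_at l.+1 x <->
  exists y d, [/\ spectrum_at l y, A d & x = y * delta + d].
Proof.
have E (d : 'I_l.+1 -> F) : \sum_(n < l.+1) d n * delta ^+ (l.+1 - n.+1) =
    (\sum_(n < l) d (lift ord_max n) * delta ^+ (l - n.+1)) * delta + d ord_max.
  rewrite big_ord_recr /= subnn mulr1 mulr_suml; congr (_ + _).
  apply: eq_bigr => n _; rewrite subSS -mulrA -exprSr subnSK//.
  by congr (d _ * _); apply: val_inj; rewrite /= /bump leqNgt ltn_ord.
split=> [[d [dA ->]]|[y [e [[d [dA ->]] eA ->]]]].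
  exists (\sum_(n < l) d (lift ord_max n) * delta ^+ (l - n.+1)), (d ord_max).
  split; [by exists (fun n => d (lift ord_max n))|exact: dA|exact: E].
exists (fun n => oapp d e (unlift ord_max n)); split.
  by move=> n; case: unliftP => [j|] _ /=.
rewrite E unlift_none; congr (_ * _ + _).
by apply: eq_bigr => n _; rewrite liftK.
Qed.

End Spectrum.

(** * Alternate bases *)

Section ExtremalDigits.
Variable A : {fset int}.
Hypothesis A0 : 0 \in A.

Lemma max_digit_in : max_digit A \in A.
Proof.
rewrite /max_digit big_seq; elim/big_ind: _ => // x y.
by rewrite maxEle; case: ifP.
Qed.

Lemma min_digit_in : min_digit A \in A.
Proof.
rewrite /min_digit big_seq; elim/big_ind: _ => // x y.
by rewrite minEle; case: ifP.
Qed.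

Lemma le_max_digit d : d \in A -> d <= max_digit A.
Proof.
rewrite /max_digit -[d \in A]/(d \in enum_fset A).
elim: (enum_fset A) => // e s IH; rewrite in_cons big_cons le_max.
by case: eqP => [->|_ /IH ->]; rewrite ?lexx ?orbT.
Qed.

Lemma ge_min_digit d : d \in A -> min_digit A <= d.
Proof.
rewrite /min_digit -[d \in A]/(d \in enum_fset A).
elim: (enum_fset A) => // e s IH; rewrite in_cons big_cons ge_min.
by case: eqP => [->|_ /IH ->]; rewrite ?lexx ?orbT.
Qed.

End ExtremalDigits.

Section AlternateBase.
Variables (R : realType) (p : nat) (beta : p.-tuple R).
Variable D : p.-tuple {fset int}.
Hypothesis p0 : (0 < p)%N.
Hypothesis beta1 : forall i : 'I_p, 1 < tnth beta i.
Hypothesis D0 : forall i : 'I_p, 0 \in tnth D i.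

Local Notation b := (base_at beta).
Local Notation G := (digits_at D).

Let resid n : 'I_p := Ordinal (ltn_pmod n p0).

Lemma base_atE n : b n = tnth beta (resid n).
Proof. by rewrite (tnth_nth 1). Qed.

Lemma digits_atE n : G n = tnth D (resid n).
Proof. by rewrite (tnth_nth fset0). Qed.

Lemma base_at_mod n m : n = m %[mod p] -> b n = b m.
Proof. by rewrite /base_at => ->. Qed.

Lemma digits_at_mod n m : n = m %[mod p] -> G n = G m.
Proof. by rewrite /digits_at => ->. Qed.

Lemma digits_at0 n : 0 \in G n.
Proof. by rewrite digits_atE. Qed.

(** Periodicity leaves finitely many bases, hence a least one. *)
Lemma uniform_base : exists gamma, 1 < gamma /\ forall n, gamma <= b n.
Proof.
exists (tnth beta [arg min_(i < resid 0) tnth beta i]%O).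
case: arg_minP => // i _ imin; split=> // n.
by rewrite base_atE imin.
Qed.

(** Again by periodicity, all the digits are bounded at once. *)
Lemma uniform_digits gamma : 1 < gamma -> exists K : R, 0 <= K /\
  forall n d, d \in G n -> `|d%:~R| <= K * (gamma - 1).
Proof.
move=> g1.
pose S : R := \sum_(i < p) \sum_(d <- tnth D i) `|d%:~R|.
have S0 : 0 <= S by apply: sumr_ge0 => i _; apply: sumr_ge0.
exists (S / (gamma - 1)); split.
  by rewrite divr_ge0// subr_ge0 ltW.
move=> n d; rewrite digits_atE => dD.
rewrite divfK ?gt_eqF ?subr_gt0// /S (bigD1 (resid n))//=.
rewrite (big_rem d)//= -addrA lerDl addr_ge0//; first exact: sumr_ge0.
by apply: sumr_ge0 => i _; apply: sumr_ge0.
Qed.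

Lemma zero_wordsE :
  zero_words beta D = [set a | admissible G 0 a /\ cancels b 0 0 a].
Proof. by rewrite /cancels oppr0. Qed.

Section Bounds.
Variables gamma K : R.
Hypothesis gamma1 : 1 < gamma.
Hypothesis gamma_le : forall n, gamma <= b n.
Hypothesis K0 : 0 <= K.
Hypothesis leK : forall n d, d \in G n -> `|d%:~R| <= K * (gamma - 1).

(** A block digit is the value reached from 0 after one period. *)
Lemma block_digitsP i x : block_digits beta D i x <->
  exists2 a, admissible G i a & x = run b i 0 a p.
Proof.
split=> [[a [aG ->]]|[a aG ->]].
  pose c j := oapp a 0 (insub j).
  have cE (j : 'I_p) : c j = a j by rewrite /c valK.
  exists c.
    move=> j; rewrite /c; case: insubP => [k _ <-|_] /=; first exact: aG.
    exact: digits_at0.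
  by rewrite run_horner; apply: eq_bigr => j _; rewrite cE.
by exists (fun j => a j); split; [move=> j; exact: aG|rewrite run_horner].
Qed.

Lemma base_product_weight n : base_product beta = weight b n p.
Proof. by rewrite (weight_period gamma1 gamma_le base_at_mod). Qed.

Lemma run_block i s a : run b i s a p = s * base_product beta + run b i 0 a p.
Proof. by rewrite run_affine mulrC -base_product_weight. Qed.

(** One Horner step in base delta is [p] steps of a walk. *)
Lemma spectrum_atP i l x :
  spectrum_at (block_digits beta D i) (base_product beta) l x <->
  walk b G i 0 (i + l * p) x.
Proof.
have il l' : (i = i + l' * p %[mod p])%N by rewrite addnC modnMDl.
elim: l x => [|l IH] x.
  rewrite mul0n addn0; apply: (iff_trans (spectrum_at0 _ _ _)).
  split=> [->|/(walkP digits_at0)[a [k [_ ik ->]]]]; first exact: walk_nil.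
  by have -> : k = 0%N by apply: (@addnI i); rewrite addn0.
apply: (iff_trans (spectrum_atS _ _ _ _)); split.
  move=> [y [d [/IH w /block_digitsP[a aG ->] ->]]].
  apply: walk_trans w _; rewrite -run_block.
  rewrite mulSnr addnA.
  apply: (walk_mod digits_at0 base_at_mod digits_at_mod (il l)).
  exact: walk_run.
move=> /(walkP digits_at0)[a [k [aG /addnI <- ->]]].
exists (run b i 0 a (l * p)%N), (run b i 0 (fun j => a (l * p + j)%N) p); split.
- by apply/IH; exact: walk_run.
- apply/block_digitsP; exists (fun j => a (l * p + j)%N) => //.
  exact: (admissible_mod digits_at_mod (esym (il l)) (admissible_shift _ aG)).
- rewrite mulSnr run_add -run_block; apply: (run_mod base_at_mod).
  exact/esym.
Qed.

Lemma spectrumP i x :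
  spectrum (block_digits beta D i) (base_product beta) x <->
  exists l, walk b G i 0 (i + l * p) x.
Proof.
split=> [[l h]|[l /spectrum_atP h]]; exists l => //.
exact/spectrum_atP.
Qed.

(** Reading [i] zeros before a word and [p - i] zeros after it moves its start and
    its end to times divisible by [p]; only the zeros at the end change the
    value. *)
Lemma spectrum_pad (i : nat) x : (i <= p)%N ->
  spectrum (block_digits beta D i) (base_product beta) x ->
  spectrum (block_digits beta D 0) (base_product beta)
    (weight b i (p - i) * x).
Proof.
move=> ip /spectrumP[l w]; apply/spectrumP; exists l.+1.
have w0 := walk_trans (walk_zeros b digits_at0 0 i) w.
apply: walk_trans w0 _.
have -> : (0 + l.+1 * p = i + l * p + (p - i))%N.
  by rewrite addnAC subnKC.
have -> : weight b i (p - i) * x = run b (i + l * p) x (fun=> 0) (p - i).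
  rewrite run_affine run_zeros addr0.
  rewrite (weight_mod base_at_mod (n := i) (m := i + l * p))//.
  by rewrite addnC modnMDl.
by apply: walk_run => j; exact: digits_at0.
Qed.

Lemma reach_spectrum C :
  spectrum (block_digits beta D 0) (base_product beta) `&` [set x | `|x| <= C]
  `<=` reach b G C 0 0.
Proof. by move=> x [/spectrumP[l w] xC]; exists (0 + l * p)%N. Qed.

(** Delay the walk by one period, and start it earlier by reading zeros, so that
    its length becomes a multiple of [p]. *)
Lemma walk_spectrum n s : walk b G 0 0 n s ->
  spectrum (block_digits beta D (n %% p)) (base_product beta) s.
Proof.
move=> w; apply/spectrumP; exists (n %/ p).+1.
have np : (n %% p + (n %/ p).+1 * p = p + n)%N.
  by rewrite mulSn addnCA [X in (p + X)%N]addnC -divn_eq.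
rewrite np.
have := walk_mod digits_at0 base_at_mod digits_at_mod (n := 0) (m := p) (l := n).
rewrite mod0n modnn add0n => /(_ _ _ erefl w); apply: walk_trans.
have := walk_zeros b digits_at0 (n %% p) (p - n %% p).
by rewrite subnKC// ltnW// ltn_mod.
Qed.

(** The extremal values, summed from index [i] on, are limits of tails indexed
    from 0. *)
Lemma limn_tail_sum i (c : nat -> int) :
  cvgn (tail_sum b i (fun j => c (i + j)%N)) ->
  limn (fun N => \sum_(i <= n < N) (c n)%:~R / \prod_(i <= k < n.+1) b k) =
  limn (tail_sum b i (fun j => c (i + j)%N)).
Proof.
move=> h; apply/cvg_lim => //; rewrite -(cvg_shiftn i).
rewrite (_ : (fun N => _) = tail_sum b i (fun j => c (i + j)%N))//.
apply/funext => N; rewrite -{1}[i]add0n big_addn addnK.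
by apply: eq_bigr => j _; rewrite /weight addnS [(j + i)%N]addnC.
Qed.

(** Compare termwise the tail [- s] with the tails of the extremal digits. *)
Lemma cancels_bounds n s a : admissible G n a -> cancels b n s a ->
  - max_value beta D n <= s <= - min_value beta D n.
Proof.
move=> aG ha.
have cmax : cvgn (tail_sum b n (fun j => max_digit (G (n + j)))).
  apply: (cvg_tail_sum gamma1 gamma_le K0 leK) => j.
  exact/max_digit_in/digits_at0.
have cmin : cvgn (tail_sum b n (fun j => min_digit (G (n + j)))).
  apply: (cvg_tail_sum gamma1 gamma_le K0 leK) => j.
  exact/min_digit_in/digits_at0.
rewrite /max_value /min_value.
rewrite (limn_tail_sum (c := fun j => max_digit (G j)) cmax).
rewrite (limn_tail_sum (c := fun j => min_digit (G j)) cmin).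
have w0 j : 0 <= (weight b n j)^-1.
  by rewrite invr_ge0 ltW// (weight_gt0 gamma1 gamma_le).
rewrite lerNl lerNr; apply/andP; split.
  apply: (ler_cvg_to ha cmax); apply: nearW => k; apply: ler_sum => j _.
  by rewrite ler_wpM2r// ler_int le_max_digit.
apply: (ler_cvg_to cmin ha); apply: nearW => k; apply: ler_sum => j _.
by rewrite ler_wpM2r// ler_int ge_min_digit.
Qed.

(** All states being final, the accepted words are those with an infinite path,
    and the path of a word can only be its sequence of Horner values. *)
Lemma accepted_zero_automaton :
  accepted (zero_automaton beta D) = zero_words beta D.
Proof.
rewrite zero_wordsE; apply/seteqP; split=> w.
  move=> [q [c [[q0 s0] qt wc _]]].
  have tr n : [/\ ((val (q n.+1)).1 = (val (q n)).1.+1 %[mod p])%N,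
      w n \in G (val (q n)).1
    & (val (q n.+1)).2 = b (val (q n)).1 * (val (q n)).2 + (w n)%:~R].
    rewrite wc; have := qt n; rewrite /transition /=.
    by case: (sval (q n)) => i s; case: (sval (q n.+1)).
  have qi n : (val (q n)).1 = (n %% p)%N :> nat.
    elim: n => [|n IH]; first by rewrite q0 mod0n.
    have [ij _ _] := tr n.
    by rewrite -[LHS](modn_small (ltn_ord _)) ij IH -addn1 modnDml addn1.
  have qs n : w n \in G n /\
      (val (q n.+1)).2 = b n * (val (q n)).2 + (w n)%:~R.
    have [_] := tr n; have inm : (val (q n)).1 = n %[mod p].
      by rewrite qi modn_mod.
    by rewrite (digits_at_mod inm) (base_at_mod inm).
  split; first by move=> j; have [] := qs j.
  pose B (i : 'I_p) := `|max_value beta D i| + `|min_value beta D i|.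
  have B0 i : 0 <= B i by exact: addr_ge0.
  apply: (bounded_cancels gamma1 gamma_le (C := \sum_i B i)) => k.
  have -> : run b 0 0 w k = (val (q k)).2.
    elim: k => [|k IH] /=; first by rewrite s0.
    by rewrite IH; have [_ ->] := qs k.
  case: (q k) => -[i s] /= /set_mem[_]; rewrite in_itv/= => /norm_le_itvN sB.
  apply: le_trans sB _; rewrite -/(B i).
  by rewrite (bigD1 i)//= lerDl sumr_ge0.
move=> [wG wc].
have st n : zero_states beta D (resid n, run b 0 0 w n).
  split; first by apply: walk_spectrum; exact: (walk_run b 0 n wG).
  rewrite in_itv /=; apply: (cancels_bounds (a := fun j => w (n + j)%N)).
    apply: (admissible_mod digits_at_mod (esym (modn_mod n p))).
    exact: (admissible_shift n wG).
  apply: (cancels_mod base_at_mod (esym (modn_mod n p))).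
  by move/(cancels_shift gamma1 gamma_le _ _ _ n): wc.
have wD n : w n \in digit_alphabet D.
  apply/bigfcupP; exists (resid n); first by rewrite mem_index_enum.
  by have := wG n; rewrite add0n digits_atE.
exists (fun n => SigSub (mem_set (st n)) : state (zero_automaton beta D)).
exists (fun n => [` wD n]%fset); split => //=.
- by rewrite mod0n.
- move=> n; split.
  + by rewrite modn_mod -[(n %% p).+1]addn1 modnDml addn1.
  + by rewrite (digits_at_mod (modn_mod n p)); exact: wG.
  + by rewrite (base_at_mod (modn_mod n p)).
- exact: infinite_nat.
Qed.

(** Bolzano-Weierstrass in X(0), after the embedding [spectrum_pad]. *)
Lemma finite_spectrum_bounded (i : 'I_p) B :
  ~ (exists x, limit_point
       (spectrum (block_digits beta D 0) (base_product beta)) x) ->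
  finite_set (spectrum (block_digits beta D i) (base_product beta) `&`
    [set x | `|x| <= B]).
Proof.
move=> noacc; apply: contrapT => inf; apply: noacc.
set E := _ `&` _ in inf.
pose c := weight b i (p - i).
have c0 : 0 < c by exact: (weight_gt0 gamma1 gamma_le).
have infc : infinite_set ((fun x => c * x) @` E).
  move=> /(finite_image (fun y => y / c)) fin; apply: inf.
  apply: sub_finite_set fin => x Ex; exists (c * x); first by exists x.
  by rewrite mulrC mulKf// gt_eqF.
have [|x xE] := infinite_bounded_limit_point_nonempty infc.
  exists (c * B); split; first exact: num_real.
  move=> M BM _ [y [_ /= yB] <-]; rewrite normrM gtr0_norm//.
  by apply: le_trans (ltW BM); rewrite ler_pM2l.
exists x; apply: limit_pointS xE => _ [y [sy _] <-].
by apply: spectrum_pad => //; exact: ltnW.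
Qed.

Lemma finite_zero_automaton :
  ~ (exists x, limit_point
       (spectrum (block_digits beta D 0) (base_product beta)) x) ->
  finite_buchi (zero_automaton beta D).
Proof.
move=> noacc; rewrite /finite_buchi /=.
have fin : finite_set (zero_states beta D).
  apply: (@sub_finite_set _ _ (\bigcup_(i in [set: 'I_p])
    (fun s => (i, s)) @`
      (spectrum (block_digits beta D i) (base_product beta) `&` [set x |
       `|x| <= `|max_value beta D i| + `|min_value beta D i|]))).
    move=> [i s] [/= sX]; rewrite in_itv/= => /norm_le_itvN sB.
    by exists i => //; exists s.
  apply: bigcup_finite => // i _; apply: finite_image.
  exact: finite_spectrum_bounded.
by rewrite (eq_finite_set (card_setT _)).
Qed.

Lemma no_limit_point (A : buchi int) : finite_buchi A ->
  accepted A = zero_words beta D ->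
  ~ (exists x, limit_point
       (spectrum (block_digits beta D 0) (base_product beta)) x).
Proof.
rewrite zero_wordsE => finA accA [x /limit_point_infinite_setP xX].
have finX := finite_core gamma1 gamma_le digits_at0 p0 base_at_mod
  finA accA.
apply: (xX (ball x 1)); first exact: nbhsx_ballx.
pose C := Num.max K (`|x| + 1).
have finR := finite_reach gamma1 gamma_le digits_at0 K0 leK p0 base_at_mod
  digits_at_mod (C := C).
apply: sub_finite_set (finR _ finX); last by rewrite le_max lexx.
move=> y [xy Xy]; apply: reach_spectrum; split => //=.
rewrite le_max; apply/orP; right.
rewrite -[y](subrK x) addrC (le_trans (ler_normD _ _))// lerD2l.
by rewrite distrC ltW.
Qed.

End Bounds.

End AlternateBase.

Theorem theorem13 (R : realType) (p : nat) (hp : (0 < p)%N)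
    (beta : p.-tuple R) (hbeta : forall i : 'I_p, 1 < tnth beta i)
    (D : p.-tuple {fset int}) (hD : forall i : 'I_p, 0 \in tnth D i) :
  [<-> exists A : buchi int, finite_buchi A /\ accepted A = zero_words beta D;
       ~ (exists x : R,
            limit_point (spectrum (block_digits beta D 0) (base_product beta)) x);
       finite_buchi (zero_automaton beta D)].
Proof.
have [gamma [gamma1 gamma_le]] := uniform_base hp hbeta.
have [K [K0 leK]] := uniform_digits D hp gamma1.
tfae.
- by move=> [A [finA accA]];
    exact: (no_limit_point hp hD gamma1 gamma_le K0 leK finA accA).
- exact: (finite_zero_automaton hp hD gamma1 gamma_le).
- move=> fin; exists (zero_automaton beta D); split => //.
  exact: (accepted_zero_automaton hp hD gamma1 gamma_le K0 leK).
Qed.
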